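(* For every integer $k$ the map $h_k\colon \mathscr{C}_{\mathbb{Z}}\to \mathscr{C}_{\mathbb{Z}}$ defined by $h_k((i,j))=(i+k,j+k)$ is an automorphism of the extended bicyclic semigroup $\mathscr{C}_{\mathbb{Z}}$, and every automorphism of $\mathscr{C}_{\mathbb{Z}}$ is equal to $h_k$ for some integer $k$. Moreover, the group $\mathbf{Aut}(\mathscr{C}_{\mathbb{Z}})$ of automorphisms of $\mathscr{C}_{\mathbb{Z}}$ is isomorphic to the additive group of integers $\mathbb{Z}(+)$, and an isomorphism $\mathfrak{H}\colon \mathbb{Z}(+)\to \mathbf{Aut}(\mathscr{C}_{\mathbb{Z}})$ is given by $\mathfrak{H}(k)=h_k$, $k\in\mathbb{Z}$.
   Context: The extended bicyclic semigroup $\mathscr{C}_{\mathbb{Z}}$ is the set $\mathbb{Z}\times\mathbb{Z}$ with the associative operation $(a,b)\cdot(c,d)=(a-b+c,d)$ if $b<c$; $(a,d)$ if $b=c$; $(a,d+b-c)$ if $b>c$. An automorphism is a bijective semigroup homomorphism of $\mathscr{C}_{\mathbb{Z}}$ onto itself; the group operation on $\mathbf{Aut}(\mathscr{C}_{\mathbb{Z}})$ is composition. *)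

(* Defs.v *)
From HB Require Import structures.
From mathcomp Require Import all_boot all_order all_algebra.
From mathcomp Require Import boolp zify.

Set Implicit Arguments.
Unset Strict Implicit.
Unset Printing Implicit Defensive.

Import Order.TTheory GRing.Theory Num.Theory.
Local Open Scope ring_scope.

Definition isomorphism (G H : magmaType) (f : G -> H) : Prop :=
  bijective f /\ {morph f : x y / (x * y)%g}.

Definition automorphism (S : magmaType) (f : S -> S) : Prop := isomorphism f.

Record Aut (S : magmaType) : Type := MkAut {
  aut_fun :> S -> S;
  autP : automorphism aut_fun
}.

Section AutGroup.
Variable S : magmaType.
Implicit Types f g : Aut S.

Lemma aut_inj f g : aut_fun f =1 aut_fun g -> f = g.
Proof.
case: f g => [f fP] [g gP] /= /funext fg; case: _ / fg gP => gP.
by congr MkAut; exact: Prop_irrelevance.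
Qed.

Lemma id_automorphism : automorphism (@idfun S).
Proof. by split=> //; exists idfun. Qed.

Lemma comp_automorphism f g : automorphism (aut_fun f \o aut_fun g).
Proof.
have [[fb fM] [gb gM]] := (autP f, autP g); split; first exact: bij_comp.
by move=> x y; rewrite /= gM fM.
Qed.

Lemma inv_automorphism f :
  {g : S -> S | [/\ cancel (aut_fun f) g, cancel g (aut_fun f)
                  & automorphism g]}.
Proof.
apply: cid; have [[g fK gK] fM] := autP f; exists g; split=> //.
split; first by exists (aut_fun f).
by move=> x y; apply: (can_inj fK); rewrite fM !gK.
Qed.

Definition aut_one : Aut S := MkAut id_automorphism.
Definition aut_mul f g : Aut S := MkAut (comp_automorphism f g).
Definition aut_inv f : Aut S :=
  let: exist g (And3 _ _ gP) := inv_automorphism f in MkAut gP.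

Lemma aut_mulA : associative aut_mul.
Proof. by move=> f g h; exact: aut_inj. Qed.

Lemma aut_mul1g : left_id aut_one aut_mul.
Proof. by move=> f; exact: aut_inj. Qed.

Lemma aut_mulg1 : right_id aut_one aut_mul.
Proof. by move=> f; exact: aut_inj. Qed.

Lemma aut_mulVg : left_inverse aut_one aut_inv aut_mul.
Proof.
move=> f; apply: aut_inj => x; rewrite /aut_inv.
by case: (inv_automorphism f) => g [fK gK gP] /=; rewrite fK.
Qed.

Lemma aut_mulgV : right_inverse aut_one aut_inv aut_mul.
Proof.
move=> f; apply: aut_inj => x; rewrite /aut_inv.
by case: (inv_automorphism f) => g [fK gK gP] /=; rewrite gK.
Qed.

HB.instance Definition _ := gen_eqMixin (Aut S).
HB.instance Definition _ := gen_choiceMixin (Aut S).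
HB.instance Definition _ :=
  isGroup.Build (Aut S) aut_mulA aut_mul1g aut_mulg1 aut_mulVg aut_mulgV.

End AutGroup.

Definition ext_bicyclic : Type := (int * int)%type.

HB.instance Definition _ := Choice.on ext_bicyclic.

Definition ext_bicyclic_mul (x y : ext_bicyclic) : ext_bicyclic :=
  let: (a, b) := x in
  let: (c, d) := y in
  if b < c then (a - b + c, d)
  else if b == c then (a, d)
  else (a, d + b - c).

Lemma ext_bicyclic_mulA : associative ext_bicyclic_mul.
Proof.
move=> [a b] [c d] [e f] /=.
by case: (ltgtP b c) => bc; case: (ltgtP d e) => de //=;
  repeat case: ltgtP => ? //=; congr (_, _); lia.
Qed.

HB.instance Definition _ := isSemigroup.Build ext_bicyclic ext_bicyclic_mulA.

Definition shift (k : int) (x : ext_bicyclic) : ext_bicyclic :=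
  let: (i, j) := x in (i + k, j + k).

(* Main.v *)
Require Import Defs.
From mathcomp Require Import all_boot all_order all_algebra.
From mathcomp Require Import boolp zify.

(* The idempotents of the extended bicyclic semigroup are the pairs (i, i), and
   they multiply by taking the maximum. An automorphism therefore acts on them
   through an increasing bijection of the integers, that is a translation
   i |-> i + k. For x = (i, j) and y = (j, i) one has xy = (i, i) and yx = (j, j),
   and both (i, i) x and x (j, j) equal x; applying the automorphism to these
   identities forces it to send x to (i + k, j + k). *)

Import Order.TTheory GRing.Theory Num.Theory.
Local Open Scope ring_scope.

(** A single formula with [Num.max] replaces the three cases, so that identities between products
    reduce to linear arithmetic. *)
Lemma ext_bicyclic_mulE (a b c d : int) :
  (((a, b) : ext_bicyclic) * (c, d))%g =
  (a + (Num.max b c - b), d + (Num.max b c - c)) :> ext_bicyclic.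
Proof.
rewrite [LHS]/(ext_bicyclic_mul (a, b) (c, d)) /=.
by case: (ltgtP b c) => bc; congr (_, _); lia.
Qed.

Lemma ext_bicyclic_idemP (x : ext_bicyclic) : (x * x)%g = x <-> x.1 = x.2.
Proof.
case: x => a b; rewrite ext_bicyclic_mulE /=; split=> [[]|->]; first lia.
by rewrite maxxx subrr addr0.
Qed.

Lemma shift_comp (k l : int) : shift (k + l) =1 shift k \o shift l.
Proof. by case=> i j; congr (_, _); lia. Qed.

Lemma shift_automorphism (k : int) : automorphism (shift k).
Proof.
split.
  by exists (shift (- k)) => -[i j]; congr (_, _); lia.
move=> [a b] [c d]; rewrite !ext_bicyclic_mulE /=.
by congr (_, _); lia.
Qed.

Lemma shift_inj : injective shift.
Proof.
move=> k l /(congr1 (fun f => (f (0, 0)).1)) /=.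
by rewrite !add0r.
Qed.

(** Consecutive values differ by exactly 1: the value [e i + 1] is attained at some [m > i], hence
    [e i < e (i + 1) <= e m = e i + 1]. *)
Lemma int_mono_bij_translation (e : int -> int) :
  {homo e : i j / i < j} -> (forall m, exists i, e i = m) ->
  forall i, e i = i + e 0.
Proof.
move=> e_lt e_surj.
have e_le : {homo e : i j / i <= j} by exact: ltW_homo.
have eS i : e (i + 1) = e i + 1.
  have [m em] := e_surj (e i + 1).
  have lt_im : i < m.
    by rewrite ltNge; apply/negP => /e_le; lia.
  have := e_lt i (i + 1); have := e_le (i + 1) m; lia.
elim/int_rec => [|n IHn|n IHn]; first by rewrite add0r.
  by rewrite (_ : n.+1%:Z = n%:Z + 1) ?eS; lia.
have := eS (- n.+1%:Z).
by rewrite (_ : - n.+1%:Z + 1 = - n%:Z); lia.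
Qed.

Lemma automorphism_shift (f : ext_bicyclic -> ext_bicyclic) :
  automorphism f -> exists k : int, f = shift k.
Proof.
case=> -[g fK gK] fM; pose e i := (f (i, i)).1.
have fE i : f (i, i) = (e i, e i).
  have /ext_bicyclic_idemP : (f (i, i) * f (i, i))%g = f (i, i).
    by rewrite -fM; congr f; apply/ext_bicyclic_idemP.
  by rewrite /e; case: (f _) => a b /= ->.
have e_inj : injective e.
  by move=> i j eij; have /(can_inj fK)[] : f (i, i) = f (j, j)
    by rewrite !fE eij.
have e_lt : {homo e : i j / i < j}.
  move=> i j lt_ij.
  (* Since [(i, i) * (j, j) = (j, j)], the maximum of [e i] and [e j] is [e j]; injectivity makes
     the inequality strict. *)
  have := fM (i, i) (j, j); rewrite !fE !ext_bicyclic_mulE.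
  rewrite (_ : (_, _) = (j, j)); last by congr (_, _); lia.
  rewrite fE => -[] eij _.
  have : e i != e j by apply/eqP => /e_inj; lia.
  lia.
have e_surj m : exists i, e i = m.
  (* As [f] is an injective morphism, the preimage of an idempotent is idempotent. *)
  have : (g (m, m)).1 = (g (m, m)).2.
    apply/ext_bicyclic_idemP/(can_inj fK).
    by rewrite fM gK; apply/ext_bicyclic_idemP.
  case gm: (g (m, m)) => [i j] /= ij; exists i.
  by rewrite /e {2}ij -gm gK.
have e_shift := int_mono_bij_translation _ e_lt e_surj.
exists (e 0); apply: funext => -[i j] /=.
rewrite -!e_shift.
have mulV a b : (((a, b) : ext_bicyclic) * (b, a))%g = (a, a).
  by rewrite ext_bicyclic_mulE; congr (_, _); lia.
have mulIl : (((i, i) : ext_bicyclic) * (i, j))%g = (i, j).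
  by rewrite ext_bicyclic_mulE; congr (_, _); lia.
have mulIr : (((i, j) : ext_bicyclic) * (j, j))%g = (i, j).
  by rewrite ext_bicyclic_mulE; congr (_, _); lia.
(* With [f (i, j) = (p, q)], the products with [(i, i)] and [(j, j)] give [e i <= p] and [e j <= q];
   those with [(j, i)] give the reverse inequalities. *)
have := fM (i, j) (j, i); have := fM (j, i) (i, j).
have := fM (i, i) (i, j); have := fM (i, j) (j, j).
rewrite !mulV mulIl mulIr !fE.
case: (f (i, j)) => p q; case: (f (j, i)) => r s.
rewrite !ext_bicyclic_mulE => -[p1 q1] [p2 q2] [p3 q3] [p4 q4].
by congr (_, _); lia.
Qed.

(* [Algebra.to_multiplicative int] is the additive group of [int], as a [groupType]. *)
Theorem theorem1p2 :
  [/\ forall k : int, automorphism (shift k),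
      forall f : ext_bicyclic -> ext_bicyclic,
        automorphism f -> exists k : int, f = shift k
    & exists H : (Algebra.to_multiplicative int : groupType) ->
                 (Aut ext_bicyclic : groupType),
        isomorphism H /\ forall k : int, aut_fun (H k) = shift k].
Proof.
split; [exact: shift_automorphism | exact: automorphism_shift |].
exists (fun k => MkAut (shift_automorphism k)); split=> //; split.
  have shiftP (f : Aut ext_bicyclic) : exists k, aut_fun f = shift k.
    exact/automorphism_shift/autP.
  (* The inverse map chooses a translation length for each automorphism; injectivity of [shift]
     makes this choice the only possible one. *)
  have [g gP] := choice shiftP.
  exists g => [k|f]; first by apply: shift_inj; rewrite -gP.
  by apply: aut_inj => x; rewrite /= gP.
move=> k l; apply: aut_inj => x; exact: shift_comp.
Qed.
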